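(* Let $G$ be a finite graph with a probability measure $\mu_G$ on its vertex set. The following are equivalent: (i) $\lim_{n\to\infty}\overline{\alpha}(G^n)=1$; (ii) $\mathrm{u}(G)=1$; (iii) there exists an independent set $I\subseteq V(G)$ such that $\mu_G(I)>\mu_G(N(I))$, where $N(I)$ is the set of vertices adjacent to at least one vertex of $I$.
   Context: Graphs may have infinitely many vertices; every graph $G$ comes with a probability measure $\mu_G$ on its vertex set. A homomorphism $h$ from $H$ to $G$ is a map $V(H)\to V(G)$ with $h(u)h(v)\in E(G)$ for every edge $uv\in E(H)$; it is measure preserving if $h$ is measurable and $\mu_H(h^{-1}(S))=\mu_G(S)$ for every measurable $S\subseteq V(G)$; write $H\to G$ if such a map exists. A graph $H$ is vertex transitive if there exist a set $S$ of measure preserving homomorphisms $\phi:V(H)\to V(H)$ and a probability measure $\nu$ on $S$ such that for almost every $v\in V(H)$, $\phi(v)$ (with $\phi\sim\nu$) has distribution $\mu_H$. A descriptor of $G$ is a vertex transitive graph $H$ with $H\to G$. $\overline{\alpha}(G)=\sup_I\mu_G(I)$ over measurable independent sets $I$, and $\mathrm{u}(G)=\inf\{\overline{\alpha}(H): H\text{ a descriptor of } G\}$. The tensor product $G\times H$ has vertex set $V(G)\times V(H)$, with $(u,v)\sim(u',v')$ iff $uu'\in E(G)$ and $vv'\in E(H)$, with the product measure; $G^n$ is the product of $n$ copies of $G$ (the sequence $\overline{\alpha}(G^n)$ is nondecreasing, so its limit exists). *)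

(* Defs.v *)
(* MathComp-Analysis, over an arbitrary realType. *)
From HB Require Import structures.
From mathcomp Require Import all_boot all_order all_algebra.
From mathcomp Require Import all_classical all_reals all_analysis.

Set Implicit Arguments.
Unset Strict Implicit.
Unset Printing Implicit Defensive.

Local Open Scope classical_set_scope.
Local Open Scope ereal_scope.

(* Simple undirected graphs; no measurability of the edge relation is
   assumed. *)
Record mgraph (R : realType) := MGraph {
  disp : measure_display;
  vertex :> measurableType disp;
  adj : vertex -> vertex -> Prop;
  adj_sym : forall x y, adj x y -> adj y x;
  adj_irr : forall x, ~ adj x x;
  gmu : probability vertex R
}.

Arguments adj {R} _ _ _.
Arguments gmu {R} _.

Section mgraph_defs.
Context {R : realType}.
Implicit Types G H : mgraph R.

(* A finite graph carries the discrete sigma-algebra. *)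
Definition finite_graph G :=
  finite_set [set: G] /\ (forall A : set G, measurable A).

Definition independent G (I : set G) :=
  forall x y, I x -> I y -> ~ adj G x y.

Definition neighborhood G (I : set G) : set G :=
  [set y | exists2 x, I x & adj G x y].

Definition alphabar G : \bar R :=
  ereal_sup [set gmu G I | I in [set I | measurable I /\ independent I]].

Definition homomorphism H G (h : H -> G) :=
  forall x y, adj H x y -> adj G (h x) (h y).

Definition measure_preserving H G (h : H -> G) :=
  measurable_fun setT h /\
  (forall A : set G, measurable A -> gmu H (h @^-1` A) = gmu G A).

Definition mp_hom H G (h : H -> G) := homomorphism h /\ measure_preserving h.

Definition maps_to H G := exists h : H -> G, mp_hom h.

(* The probability space on S is given as a probability measure nu on the
   self-maps of H, for some sigma-algebra (generated by Sigma), which is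
   concentrated on the measurable set S. *)
Definition vertex_transitive H :=
  exists (Sigma : set (set (H -> H)))
    (S : set (g_sigma_algebraType Sigma))
    (nu : probability (g_sigma_algebraType Sigma) R),
    [/\ forall phi, S phi -> mp_hom phi,
        measurable S,
        nu S = 1 &
        {ae gmu H, forall v : H,
          measurable_fun S (fun phi => phi v) /\
          (forall A : set H, measurable A ->
            nu (S `&` [set phi | A (phi v)]) = gmu H A)}].

Definition descriptor G H := vertex_transitive H /\ maps_to H G.

Definition upper_ratio G : \bar R :=
  ereal_inf [set a | exists2 H, descriptor G H & alphabar H = a].

Definition tensor_adj G H (x y : G * H) := adj G x.1 y.1 /\ adj H x.2 y.2.

Lemma tensor_adj_sym G H (x y : G * H) : tensor_adj x y -> tensor_adj y x.
Proof. by case=> ? ?; split; exact: adj_sym. Qed.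

Lemma tensor_adj_irr G H (x : G * H) : ~ tensor_adj x x.
Proof. by case=> /adj_irr. Qed.

Definition tensor G H : mgraph R :=
  @MGraph R _ (G * H)%type (@tensor_adj G H) (@tensor_adj_sym G H)
    (@tensor_adj_irr G H) (gmu G \x gmu H).

(* tensor_powerS G n is the product of n + 1 copies of G: the empty product
   would be a loop, hence not an mgraph. *)
Fixpoint tensor_powerS G (n : nat) : mgraph R :=
  if n is m.+1 then tensor (tensor_powerS G m) G else G.

End mgraph_defs.

(* Main.v *)
Require Import Defs.
From HB Require Import structures.
From mathcomp Require Import all_boot all_order all_algebra finmap.
From mathcomp Require Import all_classical all_reals all_analysis.
From mathcomp Require Import measurable_realfun ring lra.
Import Order.TTheory GRing.Theory Num.Theory.
Import numFieldNormedType.Exports.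

Set Implicit Arguments.
Unset Strict Implicit.
Unset Printing Implicit Defensive.

(* If mu(I) > mu(N(I)), give weight a < 1 to the vertices of I, 1/a to those of
   N(I) and 1 to the others. Adjacent vertices of G^n have product weights
   multiplying to at least 1, so {weight < 1} is independent; for a close to 1
   the mean weight on G is some rho < 1, so by Markov's inequality this set has
   measure at least 1 - rho^n. Moreover, in a descriptor H of G two typical
   vertices are never adjacent, since their random images would satisfy
   P(h(phi x) in I) > P(h(phi y) in N(I)).
   Otherwise a weighted Hall theorem yields edge weights with marginals mu, that
   is, a random edge of G whose two ends have law mu. It can be realised on a
   circle whose edges join antipodal points, a vertex-transitive graph by
   rotation. A random edge with both ends distributed by the measure persists in
   tensor powers, and it bounds the independence ratio by 1/2. *)

Local Open Scope classical_set_scope.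
Local Open Scope ring_scope.

(** * Fractional matchings with prescribed vertex sums, and the Hall-type obstruction *)

Section fractional_matching.
Context {R : realType} {T : finType} (e : rel T) (m : T -> R).
Hypothesis e_sym : symmetric e.
Hypothesis e_irr : irreflexive e.
Hypothesis m_ge0 : forall u, 0 <= m u.

(** Symmetry and support on edges are built into [sym_weight], so that [w] itself ranges over a
    plain box. *)
Let sym_weight (w : T * T -> R) u v := if e u v then w (u, v) + w (v, u) else 0.
Let resid (w : T * T -> R) u := \sum_v sym_weight w u v - m u.
Let energy (w : T * T -> R) := \sum_u resid w u ^+ 2.
(** Chosen so large that a minimiser stays strictly below it on every edge: the upper face of the
    box never constrains. *)
Let bound := \sum_u m u + \sum_u m u ^+ 2 + 2.
Let box := [set w : T * T -> R | forall p, `[0, bound]%classic (w p)].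

Let sym_weightC w u v : sym_weight w u v = sym_weight w v u.
Proof. by rewrite /sym_weight e_sym addrC. Qed.

Let bump (w : T * T -> R) (p : T * T) (t : R) q := w q + t *+ (q == p).

Let resid_bump w a b t u : e a b ->
  resid (bump w (a, b) t) u = resid w u + t *+ (u == a) + t *+ (u == b).
Proof.
move=> eab; rewrite /resid.
have sE v : sym_weight (bump w (a, b) t) u v = sym_weight w u v +
    (t *+ ((u == a) && (v == b)) + t *+ ((u == b) && (v == a))).
  rewrite /sym_weight /bump !xpair_eqE (andbC (v == a)) addrACA.
  case: ifPn => // /negbTE euv; rewrite add0r.
  have -> : (u == a) && (v == b) = false.
    by apply/negbTE; apply: contraFN euv => /andP[/eqP -> /eqP ->].
  have -> : (u == b) && (v == a) = false.
    by apply/negbTE; apply: contraFN euv => /andP[/eqP -> /eqP ->]; rewrite e_sym.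
  by rewrite addr0.
under eq_bigr => v _ do rewrite sE.
have sum1 c d : \sum_v t *+ ((u == c) && (v == d)) = t *+ (u == c).
  rewrite (bigD1 d) //= eqxx andbT big1 ?addr0// => v /negbTE ->.
  by rewrite andbF mulr0n.
rewrite !big_split /= !sum1; ring.
Qed.

(** Since [a] and [b] differ, exactly two residuals move by [t]; the sign of [resid w a + resid w b]
    therefore governs the first variation. *)
Let energy_bump w a b t : e a b ->
  energy (bump w (a, b) t) =
  energy w + 2 * t * (resid w a + resid w b + t).
Proof.
move=> eab; rewrite /energy.
have ab : a != b by apply: contraTneq eab => ->; rewrite e_irr.
under eq_bigr => u _ do rewrite resid_bump//.
rewrite (bigD1 a) //= (bigD1 b) 1?eq_sym //= [in RHS](bigD1 a) //=.
rewrite [in RHS](bigD1 b) 1?eq_sym //= !eqxx (negbTE ab) !mulr0n !mulr1n.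
rewrite (eq_bigr (fun u => resid w u ^+ 2)); first by ring.
by move=> u /andP[/negbTE -> /negbTE ->]; rewrite !addr0.
Qed.

Let sum_le1 (F : T -> R) u : (forall v, 0 <= F v) -> F u <= \sum_v F v.
Proof. by move=> F0; rewrite (bigD1 u) //= lerDl sumr_ge0. Qed.

Let W := prod_topology (fun _ : T * T => R).

Let energy_continuous : continuous (energy : W -> R).
Proof.
have cw p : continuous (fun w : W => w p).
  exact: (@proj_continuous _ (fun _ : T * T => R)).
have cD (f g : W -> R) : continuous f -> continuous g ->
    continuous (fun w => f w + g w).
  by move=> cf cg w; exact: (cvgD (cf w) (cg w)).
have cs u v : continuous (fun w : W => sym_weight w u v).
  by rewrite /sym_weight; case: (e u v); [apply: cD; exact: cw|exact: cst_continuous].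
apply: continuous_big => [|u _]; first exact: add_continuous.
have cr : continuous (fun w : W => resid w u).
  apply: cD; last exact: cst_continuous.
  by apply: continuous_big => [|v _]; [exact: add_continuous|exact: cs].
by move=> w; exact: (cvgM (cr w) (cr w)).
Qed.

(** In the product topology the box is compact by Tychonoff's theorem and the energy is
    continuous. *)
Let energy_min : exists2 w, box w & forall z, box z -> energy w <= energy z.
Proof.
have bound0 : 0 <= bound by rewrite !addr_ge0// sumr_ge0// => u _; rewrite sqr_ge0.
have box0 : box (fun=> 0) by move=> p /=; rewrite in_itv /= lexx.
have cbox : compact (box : set W).
  apply: (@tychonoff _ (fun _ => R) (fun _ => `[0, bound]%classic)) => _.
  exact: segment_compact.
have [|w wbox wmin] := @compact_EVT_min W R energy box (ex_intro _ _ box0) cbox.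
  by apply: continuous_subspaceT; exact: energy_continuous.
by exists w; [exact/set_mem | move=> z zb; apply: wmin; exact/mem_set].
Qed.

(* Minimise the squared deviation of the vertex sums from [m]; if the minimum
   is not 0, the vertices with the most negative residual form the set [I]. *)
Lemma fractional_matching :
  (exists w : T -> T -> R, [/\ forall u v, 0 <= w u v,
     forall u v, w u v != 0 -> e u v, forall u v, w u v = w v u &
     forall u, \sum_v w u v = m u]) \/
  (exists2 I : {set T}, {in I &, forall x y, ~~ e x y} &
     \sum_(v | [exists u in I, e u v]) m v < \sum_(u in I) m u).
Proof.
have [w wbox wmin] := energy_min.
have w0 p : 0 <= w p by have := wbox p; rewrite /= in_itv /= => /andP[].
have wb p : w p <= bound by have := wbox p; rewrite /= in_itv /= => /andP[].
have s0 u v : 0 <= sym_weight w u v by rewrite /sym_weight; case: ifP; rewrite ?addr_ge0.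
pose r := resid w.
have dE u : \sum_v sym_weight w u v = m u + r u by rewrite /r /resid; ring.
have energy0 : energy w <= \sum_u m u ^+ 2.
  have -> : \sum_u m u ^+ 2 = energy (fun=> 0).
    apply: eq_bigr => u _; rewrite /resid /sym_weight big1 ?sub0r ?sqrrN //.
    by move=> v _; rewrite addr0 if_same.
  apply: wmin => p /=; rewrite in_itv /= lexx /=.
  by rewrite !addr_ge0// sumr_ge0// => u _; rewrite sqr_ge0.
(* [w (a, b)] is at most [m a + r a], and [r a ^+ 2] is at most the energy of the zero weight. *)
have wlt a b : e a b -> w (a, b) < bound.
  move=> eab; apply: (@le_lt_trans _ _ (m a + r a)).
    rewrite -dE; apply: (@le_trans _ _ (sym_weight w a b)); last exact: sum_le1.
    by rewrite /sym_weight eab lerDl.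
  have := @sum_le1 m a m_ge0.
  have : r a ^+ 2 <= \sum_u m u ^+ 2.
    apply: le_trans energy0; apply: (@sum_le1 (fun u => r u ^+ 2)) => u.
    exact: sqr_ge0.
  rewrite /bound; have := sqr_ge0 (r a - 1); nra.
have perturb a b t : e a b -> 0 <= w (a, b) + t <= bound ->
    0 <= t * (r a + r b + t).
  move=> eab ht; have : energy w <= energy (bump w (a, b) t).
    apply: wmin => p /=; rewrite in_itv /= /bump.
    by case: eqVneq => [->|_]; rewrite ?mulr1n// mulr0n addr0 w0 wb.
  rewrite energy_bump// -/r; lra.
(* Otherwise raising [w (a, b)] slightly lowers the energy. The half in [t] keeps [r a + r b + t]
   negative. *)
have r_ge a b : e a b -> 0 <= r a + r b.
  move=> eab; rewrite leNgt; apply/negP => rlt.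
  have wl := wlt _ _ eab; have ww := w0 (a, b).
  pose t := Num.min (bound - w (a, b)) (- (r a + r b) / 2).
  have t0 : 0 < t by rewrite lt_min; apply/andP; split; lra.
  have t1 : t <= bound - w (a, b) by rewrite ge_min lexx.
  have t2 : t <= - (r a + r b) / 2 by rewrite ge_min lexx orbT.
  have /(perturb a b t eab) : 0 <= w (a, b) + t <= bound by apply/andP; split; lra.
  by rewrite pmulr_rge0//; lra.
(* Complementary slackness: a positive weight can also be lowered. *)
have r_le0 a b : e a b -> 0 < w (a, b) -> r a + r b <= 0.
  move=> eab wpos; rewrite leNgt; apply/negP => rgt.
  have ww := wb (a, b).
  pose t := Num.min (w (a, b)) ((r a + r b) / 2).
  have t0 : 0 < t by rewrite lt_min; apply/andP; split; lra.
  have t1 : t <= w (a, b) by rewrite ge_min lexx.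
  have t2 : t <= (r a + r b) / 2 by rewrite ge_min lexx orbT.
  have /(perturb a b (- t) eab) : 0 <= w (a, b) - t <= bound by apply/andP; split; lra.
  by rewrite mulNr oppr_ge0 pmulr_rle0//; lra.
have r_le a b : sym_weight w a b != 0 -> e a b /\ r a + r b <= 0.
  rewrite /sym_weight; case: (boolP (e a b)) => [eab|_]; last by rewrite eqxx.
  move=> /negP sn0; split=> //.
  have := w0 (a, b); rewrite le_eqVlt => /predU1P[wab|]; last exact: r_le0.
  have := w0 (b, a); rewrite le_eqVlt => /predU1P[wba|].
    by case: sn0; rewrite -wab -wba addr0.
  by rewrite addrC; apply: r_le0; rewrite e_sym.
have [/existsP[u1 ru1]|/existsPn rge0] := boolP [exists u, r u < 0]; [right|left].
  have /andP[] : (r [arg min_(i < u1) r i]%O < 0) &&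
      [forall v, r [arg min_(i < u1) r i]%O <= r v].
    case: Order.TotalTheory.arg_minP => // i _ ri.
    by apply/andP; split; [exact: le_lt_trans (ri _ _) ru1|apply/forallP => v; exact: ri].
  move: [arg min_(i < u1) r i]%O => u0 ru0 /forallP rmin.
  (* [I] collects the vertices of minimal, hence negative, residual; by [r_ge] their neighbours have
     positive residual. *)
  pose I := [set u | r u <= r u0]%SET; pose N := [pred v | [exists u in I, e u v]].
  have Nr v : N v -> 0 <= r v + r u0.
    move=> /existsP[u /andP[]]; rewrite inE => ru /r_ge; lra.
  exists I.
    move=> x y; rewrite !inE => rx ry; apply/negP => /r_ge; lra.
  have rI : \sum_(u in I) r u < 0.
    rewrite (bigD1 u0) /= ?inE//.
    have : \sum_(i in I | i != u0) r i <= 0.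
      by apply: sumr_le0 => i /andP[]; rewrite inE => /le_trans + _; apply; exact: ltW.
    lra.
  have rN : 0 <= \sum_(v | N v) r v by apply: sumr_ge0 => v /Nr; lra.
  (* All the weight at a vertex of [N] comes from [I]: by [r_le], the other end of a charged edge
     has residual at most [r u0]. As the vertex sums are [m + r], the signs of [rI] and [rN] then
     give the strict inequality for [m]. *)
  have : \sum_(v | N v) \sum_u sym_weight w v u <= \sum_(u in I) \sum_v sym_weight w u v.
    rewrite (eq_bigr (fun v => \sum_(u in I) sym_weight w v u)); last first.
      move=> v /Nr Nv; rewrite (bigID (mem I)) /= [X in _ + X]big1 ?addr0// => u.
      rewrite inE -ltNge => ru; apply/eqP; apply: contraT => /r_le[_]; lra.
    rewrite exchange_big /=; apply: ler_sum => u _.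
    rewrite [leRHS](bigID N) /= (eq_bigr _ (fun v _ => sym_weightC w v u)).
    by rewrite lerDl sumr_ge0.
  under [X in X <= _ -> _]eq_bigr => u _ do rewrite dE.
  under [X in _ <= X -> _]eq_bigr => u _ do rewrite dE.
  by clearbody r; rewrite !big_split /=; lra.
exists (sym_weight w); split => //.
- by move=> u v /r_le[].
move=> u; rewrite dE; have ru : 0 <= r u by rewrite leNgt.
suff -> : r u = 0 by rewrite addr0.
apply/eqP; rewrite eq_le ru andbT leNgt; apply/negP => rpos.
(* A positive residual at [u] would make every edge at [u] uncharged, since no residual is negative,
   and yet the sum at [u] would be positive. *)
have /eqP : \sum_v sym_weight w u v != 0 by rewrite dE; have := m_ge0 u; lra.
apply; apply: big1 => v _; apply/eqP; apply: contraT => /r_le[_].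
have := rge0 v; rewrite -leNgt; lra.
Qed.

End fractional_matching.

(** * The circle, its rotations, and step functions with a given distribution *)

Section circle.
Context {R : realType}.
Local Notation mu := (@lebesgue_measure R).
Local Notation RR := (measurableTypeR R).

Lemma measurable_shift (c : R) : measurable_fun [set: RR] ((fun x => x + c) : RR -> RR).
Proof. exact: measurable_funD. Qed.

Lemma lebesgue_measure_shift (c : R) (A : set RR) : measurable A ->
  mu ((fun x => x + c) @^-1` A) = mu A.
Proof.
move=> mA; apply/esym; have mshift := @measurable_shift c.
rewrite (@lebesgue_measure_unique _ (pushforward mu ((fun x => x + c) : RR -> RR)))//.
move=> _ [[a b]] _ <-; rewrite [RHS](_ : _ = mu ((fun x => x + c) @^-1` `]a, b]))//=.
rewrite (_ : _ @^-1` _ = `]a - c, b - c]%classic); last first.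
  by apply/seteqP; split=> x /=; rewrite !in_itv /=; lra.
rewrite !lebesgue_measure_itv/= !lte_fin ltrD2r.
by case: ifP => // _; rewrite -!EFinB; congr EFin; ring.
Qed.

(** The circle is encoded as the whole line with Lebesgue measure restricted to the fundamental
    domain [0, 1), all other points being null. *)
Definition circle_mu : set RR -> \bar R :=
  mrestr mu (measurable_itv `[0 : R, 1[).

HB.instance Definition _ := Measure.on circle_mu.

Let circle_muT : circle_mu setT = 1%E.
Proof.
by rewrite /circle_mu /mrestr setTI lebesgue_measure_itv/= lte_fin ltr01 oppr0 adde0.
Qed.

HB.instance Definition _ := @Measure_isProbability.Build _ _ R circle_mu circle_muT.

(** Addition modulo 1, extended by the identity so that it preserves [circle_mu] for every real
    [s]. *)
Definition rotation (s x : R) : R :=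
  if (0 <= s < 1) && (0 <= x < 1) then
    if x + s < 1 then x + s else x + s - 1
  else x.

Lemma rotation_itv s x : 0 <= x < 1 -> 0 <= rotation s x < 1.
Proof. by rewrite /rotation; do !case: ifP => ?; lra. Qed.

Lemma rotationC s x : 0 <= s < 1 -> 0 <= x < 1 -> rotation s x = rotation x s.
Proof. by rewrite /rotation addrC andbC => -> ->. Qed.

Lemma measurable_circle : measurable_fun [set: RR] (fun x : R => 0 <= x < 1).
Proof.
apply: measurable_and; first exact: measurable_fun_ler.
exact: measurable_fun_ltr.
Qed.

Let measurable_shift1 (c : R) :
  measurable_fun [set: RR] ((fun x => if x + c < 1 then x + c else x + c - 1) : RR -> RR).
Proof.
apply: measurable_fun_ifT; first by apply: measurable_fun_ltr => //; exact: measurable_shift.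
  exact: measurable_shift.
rewrite (_ : (fun _ => _) = (fun x => x + (c - 1))); last by apply/funext => x; ring.
exact: measurable_shift.
Qed.

Lemma measurable_rotation s : measurable_fun [set: RR] (rotation s : RR -> RR).
Proof.
apply: measurable_fun_ifT; [|exact: measurable_shift1|by []].
by apply: measurable_and => //; exact: measurable_circle.
Qed.

Lemma measurable_rotation_angle x :
  measurable_fun [set: RR] ((fun s => rotation s x) : RR -> RR).
Proof.
apply: measurable_fun_ifT; [by apply: measurable_and => //; exact: measurable_circle| |by []].
by under eq_fun do rewrite addrC; exact: measurable_shift1.
Qed.

(** Cutting the target at [s] makes the preimage a disjoint union of two translates, by [s] and by
    [s - 1]. *)
Lemma circle_mu_rotation s (A : set RR) : measurable A ->
  circle_mu (rotation s @^-1` A) = circle_mu A.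
Proof.
move=> mA; have [s01|/negbTE s01] := boolP (0 <= s < 1); last first.
  by rewrite /rotation s01.
have mAl : measurable (A `&` `[0, s[ : set RR) by exact: measurableI.
have mAr : measurable (A `&` `[s, 1[ : set RR) by exact: measurableI.
rewrite /circle_mu /mrestr.
have -> : rotation s @^-1` A `&` `[0, 1[ =
    (fun x => x + (s - 1)) @^-1` (A `&` `[0, s[) `|`
    (fun x => x + s) @^-1` (A `&` `[s, 1[).
  apply/seteqP; split=> x /=; rewrite !in_itv /= /rotation s01 /=.
  - move=> [+ x01]; rewrite x01; case: ifP => xs Ax; [right|left].
      by split => //; lra.
    by rewrite addrA; split => //; lra.
  - move=> [] [+ xs].
      have -> : 0 <= x < 1 by lra.
      have -> : (x + s < 1) = false by lra. by rewrite -addrA; split.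
    have -> : 0 <= x < 1 by lra.
    have -> : x + s < 1 by lra.
    by split.
have -> : A `&` `[0, 1[ = (A `&` `[0, s[) `|` (A `&` `[s, 1[).
  apply/seteqP; split=> x /=; rewrite !in_itv /=.
  - by move=> [Ax x01]; case: (ltP x s) => xs; [left|right]; split=> //; lra.
  - by move=> [] [Ax xs]; split=> //; lra.
rewrite !measureU//.
- by congr (_ + _)%E; exact: lebesgue_measure_shift.
- by apply/seteqP; split=> x //=; rewrite !in_itv /=; lra.
- by rewrite -[X in measurable X]setTI; exact: measurable_shift.
- by rewrite -[X in measurable X]setTI; exact: measurable_shift.
- by apply/seteqP; split=> x //=; rewrite !in_itv /=; lra.
Qed.

(** Intervals of lengths [w t] are laid end to end from [c], so Lebesgue measure is pushed to the
    weights; [t0] is the value beyond the last one. *)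
Lemma step_function (T : choiceType) (t0 : T) (s : seq T) (w : T -> R) (c : R) :
    (forall t, 0 <= w t) ->
  exists g : R -> T, [/\ forall x, g x \in t0 :: s,
    forall A : set T, measurable (g @^-1` A : set RR) &
    forall A : set T, mu (`[c, c + \sum_(t <- s) w t[ `&` g @^-1` A) =
      (\sum_(t <- s | t \in A) w t)%:E].
Proof.
move=> w0; elim: s c => [|t s IH] c.
  exists (fun=> t0); split => [x|A|A].
  - exact: mem_head.
  - by rewrite preimage_cst; case: ifP.
  - by rewrite !big_nil addr0 set_itvco0 set0I measure0.
have [g [gs mg gE]] := IH (c + w t).
(* The value [t] also covers everything to the left of [c], outside the measured window. *)
exists (fun x => if x < c + w t then t else g x); split.
- move=> x; case: ifP => _; first by rewrite !inE eqxx orbT.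
  by have := gs x; rewrite !inE => /orP[->//|->]; rewrite !orbT.
- move=> A.
  pose B := if t \in A then `]-oo, (c + w t)[%classic else (set0 : set R).
  have -> : (fun x => if x < c + w t then t else g x) @^-1` A =
      B `|` (`[c + w t, +oo[ `&` g @^-1` A).
    apply/seteqP; split=> x /=; rewrite in_itv /= andbT /B.
      case: ltP => xc Ax; last by right.
      by left; rewrite mem_set//= in_itv.
    move=> [|[xc gx]]; last by rewrite ltNge xc.
    by case: ifP => // /set_mem At /=; rewrite in_itv /= => ->.
  apply: measurableU; first by rewrite /B; case: ifP.
  by apply: measurableI.
- move=> A.
  pose B := if t \in A then `[c, (c + w t)[%classic else (set0 : set R).
  rewrite !big_cons addrA.
  set I := `[c + w t, _[%classic in gE.
  have -> : `[c, c + w t + \sum_(j <- s) w j[ `&`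
      (fun x => if x < c + w t then t else g x) @^-1` A =
      B `|` (I `&` g @^-1` A).
    rewrite /I /B; apply/seteqP; split=> x /=; rewrite !in_itv /=.
      move=> [xc]; case: ltP => xcw Ax; last by right; split=> //; lra.
      by left; rewrite mem_set//= in_itv /=; lra.
    have wt := w0 t; have ws : 0 <= \sum_(j <- s) w j by exact: sumr_ge0.
    move=> [|[xc gx]]; last first.
      have -> : (x < c + w t) = false by lra.
      by split=> //; lra.
    case: ifP => // /set_mem At /=; rewrite in_itv /= => xc.
    have -> : x < c + w t by lra.
    by split=> //; lra.
  rewrite measureU; last 3 first.
  + by rewrite /B; case: ifP.
  + by apply: measurableI; [exact: measurable_itv|exact: mg].
  + apply/seteqP; split=> x //= -[]; rewrite /B /I.
    by case: ifP => //= _; rewrite !in_itv /=; lra.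
  have muI : mu `[c, c + w t[ = (w t)%:E.
    have := w0 t; rewrite lebesgue_measure_itv/= lte_fin ltrDl lt0r => ->.
    rewrite andbT -EFinB; case: eqVneq => [->//|_].
    by congr EFin; rewrite /=; ring.
  rewrite [X in (_ + X)%E]gE /B; case: ifP => _; last by rewrite measure0 add0e.
  by rewrite EFinD; congr (_ + _)%E; exact: muI.
Qed.

End circle.

(** * Random edges with both ends distributed by the measure *)

Section coupled.
Context {R : realType}.
Implicit Types H K L : mgraph R.

(* A random edge whose two ends are both distributed by [gmu K]. *)
Definition coupled K :=
  exists d (Om : measurableType d) (P : probability Om R) (s t : Om -> K),
  [/\ forall o, adj K (s o) (t o), measurable_fun setT s, measurable_fun setT t,
      forall A, measurable A -> P (s @^-1` A) = gmu K A &
      forall A, measurable A -> P (t @^-1` A) = gmu K A].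

(** The two ends never lie together in an independent set [J], so two disjoint events of probability
    [gmu K J] fit in total mass 1. *)
Lemma coupled_alphabar K : coupled K -> (alphabar K <= (2^-1)%:E)%E.
Proof.
move=> [d [Om [P [s [t [ad ms mt sE tE]]]]]]; apply: ge_ereal_sup => _ [J [mJ iJ] <-].
have msJ : measurable (s @^-1` J) by rewrite -[X in measurable X]setTI; exact: ms.
have mtJ : measurable (t @^-1` J) by rewrite -[X in measurable X]setTI; exact: mt.
have : (P (s @^-1` J `|` t @^-1` J) <= 1)%E by apply: probability_le1; exact: measurableU.
rewrite measureU//; last first.
  by apply/seteqP; split=> o //= [sJ tJ]; exact: (iJ _ _ sJ tJ (ad o)).
rewrite [X in (X + _)%E]sE// [X in (_ + X)%E]tE//.
rewrite -[gmu K J]fineK ?fin_num_measure// -EFinD !lee_fin; lra.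
Qed.

Lemma coupled_maps_to H K : maps_to H K -> coupled H -> coupled K.
Proof.
move=> [h [hh [mh hE]]] [d [Om [P [s [t [ad ms mt sE tE]]]]]].
exists d, Om, P, (h \o s), (h \o t); split.
- by move=> o; exact/hh/ad.
- exact: measurableT_comp.
- exact: measurableT_comp.
- move=> A mA; rewrite comp_preimage sE ?hE// -[X in measurable X]setTI; exact: mh.
- move=> A mA; rewrite comp_preimage tE ?hE// -[X in measurable X]setTI; exact: mh.
Qed.

(** A product measure is determined by its values on rectangles, where the preimage is again a
    rectangle. *)
Let pushforward_pair d d' (Om : measurableType d) (Om' : measurableType d')
    (P : probability Om R) (P' : probability Om' R) K L (s : Om -> K) (s' : Om' -> L) :
    measurable_fun setT s -> measurable_fun setT s' ->
    (forall A, measurable A -> P (s @^-1` A) = gmu K A) ->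
    (forall A, measurable A -> P' (s' @^-1` A) = gmu L A) ->
  let f := (fun o : Om * Om' => (s o.1, s' o.2)) in
  measurable_fun setT f /\
  forall A, measurable A -> (P \x P')%E (f @^-1` A) = (gmu K \x gmu L)%E A.
Proof.
move=> ms ms' sE s'E f.
have mf : measurable_fun setT f.
  apply: measurable_fun_pair; first exact: (measurableT_comp ms measurable_fst).
  exact: (measurableT_comp ms' measurable_snd).
split=> // A mA; apply/esym.
pose X : {mfun (Om * Om')%type >-> (K * L)%type} := HB.pack f (isMeasurableFun.Build _ _ _ _ f mf).
apply: (@product_measure_unique _ _ _ _ _ _ _ (distribution (P \x P')%E X)) => //.
move=> B C mB mC; rewrite /distribution /pushforward /=.
have -> : f @^-1` (B `*` C) = (s @^-1` B) `*` (s' @^-1` C) by [].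
rewrite product_measure1E.
- by rewrite -sE// -s'E.
- by rewrite -[X in measurable X]setTI; exact: ms.
- by rewrite -[X in measurable X]setTI; exact: ms'.
Qed.

(** Two independent random edges form a random edge of the product. *)
Lemma coupled_tensor K L : coupled K -> coupled L -> coupled (tensor K L).
Proof.
move=> [d [Om [P [s [t [ad ms mt sE tE]]]]]] [d' [Om' [P' [s' [t' [ad' ms' mt' sE' tE']]]]]].
have [mss ssE] := pushforward_pair ms ms' sE sE'.
have [mtt ttE] := pushforward_pair mt mt' tE tE'.
exists _, (Om * Om')%type, (P \x P')%E, (fun o => (s o.1, s' o.2)),
  (fun o => (t o.1, t' o.2)); split=> //.
by move=> o; split; [exact: ad|exact: ad'].
Qed.

Lemma coupled_tensor_powerS K n : coupled K -> coupled (tensor_powerS K n).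
Proof. by move=> cK; elim: n => //= n IH; exact: coupled_tensor. Qed.

End coupled.

(** * Rotation-invariant graphs on the circle are vertex transitive *)

Section circle_graph.
Context {R : realType}.
Local Notation RR := (measurableTypeR R).
Variable e : R -> R -> Prop.
Hypothesis e_sym : forall x y, e x y -> e y x.
Hypothesis e_irr : forall x, ~ e x x.

Definition circle_graph : mgraph R := @MGraph R _ RR e e_sym e_irr (@circle_mu R).

Lemma circle_vertex_transitive :
  (forall s x y, e x y -> e (rotation s x) (rotation s y)) -> vertex_transitive circle_graph.
Proof.
move=> e_rot.
(* The largest sigma-algebra on self-maps for which [rotation] is measurable: membership is tested
   by pulling back to the angle. The measure [nu] below is the law of the rotation by a uniform
   angle. *)
pose Sigma : set (set (R -> R)) := [set B | measurable (rotation @^-1` B : set RR)].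
have sS : sigma_algebra setT Sigma.
  split.
  - by rewrite /Sigma /= preimage_set0.
  - move=> B mB; rewrite /Sigma /= setTD preimage_setC; exact: measurableC.
  - by move=> F mF; rewrite /Sigma /= preimage_bigcup; exact: bigcupT_measurable.
have mrot : measurable_fun [set: RR] (rotation : RR -> g_sigma_algebraType Sigma).
  apply: (@measurability _ _ RR (g_sigma_algebraType Sigma) _ _ Sigma) => // _ [B SB <-].
  by rewrite setTI.
pose X : {mfun RR >-> g_sigma_algebraType Sigma} :=
  HB.pack (rotation : RR -> g_sigma_algebraType Sigma) (isMeasurableFun.Build _ _ _ _ _ mrot).
have rotr x : measurable_fun [set: RR] (fun s => rotation s x : RR).
  exact: measurable_rotation_angle.
have mran : measurable (range rotation : set (g_sigma_algebraType Sigma)).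
  by apply: sub_sigma_algebra; rewrite /Sigma /= preimage_range.
have mev (v : R) (A : set RR) : measurable A ->
   measurable (range rotation `&` [set phi | A (phi v)] : set (g_sigma_algebraType Sigma)).
  move=> mA; apply: sub_sigma_algebra; rewrite /Sigma /= preimage_setI preimage_range setTI.
  by rewrite -[X in measurable X]setTI; exact: rotr.
exists Sigma, (range rotation), (distribution (@circle_mu R) X); split.
- move=> _ [s _ <-]; split; first exact: e_rot.
  by split; [exact: measurable_rotation|move=> A mA; exact: circle_mu_rotation].
- exact: mran.
- by rewrite /distribution /pushforward /= preimage_range probability_setT.
- exists (~` `[0, 1[%classic); split.
  + by apply: measurableC.
  + by rewrite /circle_graph /= /circle_mu /mrestr setICl measure0.
  + apply: subsetC => v v01; split.
      by move=> _ A mA; exact: mev.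
    move=> A mA.
    transitivity (circle_mu ((fun s => rotation s v) @^-1` A)).
      congr circle_mu; apply/seteqP; split=> s /=; first by case.
      by split=> //; exists s.
    (* Exchanging angle and point turns the law of the moved point into invariance under rotation by
       [v]. *)
    rewrite /= -(circle_mu_rotation v mA) /circle_mu /mrestr /=; congr (lebesgue_measure _).
    apply/seteqP; split=> s /= [+ s01]; rewrite rotationC//; split=> //.
Qed.

End circle_graph.

(** * Consequences of an independent set larger than its neighbourhood *)

Section expanding.
Context {R : realType}.
Implicit Types G H : mgraph R.

Lemma alphabar_le1 G : (alphabar G <= 1)%E.
Proof. by apply: ge_ereal_sup => _ [I [mI _] <-]; exact: probability_le1. Qed.

Lemma alphabar_ge G I : measurable I -> independent I -> (gmu G I <= alphabar G)%E.
Proof. by move=> mI iI; apply: ereal_sup_ubound; exists I. Qed.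

(* Compares the two events on the space of maps for fixed vertices: Fubini is
   unavailable, as evaluation need not be jointly measurable. *)
Lemma vertex_transitive_alphabar1 G H I :
    (forall A : set G, measurable A) -> descriptor G H -> independent I ->
  (gmu G (neighborhood I) < gmu G I)%E -> alphabar H = 1%E.
Proof.
move=> mG [[Sigma [S [nu [homS mS nuS [B [mB B0 subB]]]]]] [h [hh [mh hE]]]] iI ltI.
(* Off the null set [B], the random vertex [h (phi v)] has law [gmu G]. *)
have good v : ~ B v -> forall A : set G,
    measurable (S `&` [set phi | A (h (phi v))]) /\
    nu (S `&` [set phi | A (h (phi v))]) = gmu G A.
  move=> Bv; have [mv vE] : measurable_fun S (fun phi : g_sigma_algebraType Sigma => phi v) /\
      (forall A : set H, measurable A ->
        nu (S `&` [set phi | A (phi v)]) = gmu H A).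
    by apply: contrapT => nv; apply: Bv; exact: subB.
  move=> A; have mhA : measurable (h @^-1` A).
    by rewrite -[X in measurable X]setTI; apply: mh.
  split; first exact: (mv mS _ mhA).
  by rewrite -hE//; exact: vE.
apply/eqP; rewrite eq_le alphabar_le1 /=.
(* The complement of [B], of full measure, is shown to be independent. *)
have <- : gmu H (~` B) = 1%E by rewrite probability_setC// B0 sube0.
apply: alphabar_ge; first exact: measurableC.
move=> x y Bx By xy.
have [mI IE] := good x Bx I.
have [mN NE] := good y By (neighborhood I).
move: ltI; rewrite ltNge => /negP; apply; rewrite -IE -NE.
apply: le_measure; rewrite ?inE// => phi [Sphi Iphi]; split=> //.
by exists (h (phi x)) => //; apply: hh; exact: (homS _ Sphi).1.
Qed.

Section power_weight.
Context (G : mgraph R) (w : G -> R).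
Hypothesis w_gt0 : forall x, 0 < w x.
Hypothesis w_adj : forall x y, adj G x y -> 1 <= w x * w y.
Hypothesis mw : measurable_fun setT w.

Fixpoint power_weight n : tensor_powerS G n -> R :=
  match n return tensor_powerS G n -> R with
  | 0 => w
  | m.+1 => fun x => power_weight x.1 * w x.2
  end.

Let pw_gt0 n (x : tensor_powerS G n) : 0 < power_weight x.
Proof. by elim: n x => [|n IH] x //=; rewrite mulr_gt0. Qed.

Let pw_adj n (x y : tensor_powerS G n) :
  adj _ x y -> 1 <= power_weight x * power_weight y.
Proof.
elim: n x y => [|n IH] x y /=; first exact: w_adj.
by move=> [/IH h1 /w_adj h2]; rewrite mulrACA mulr_ege1.
Qed.

Let mpw n : measurable_fun setT (@power_weight n).
Proof.
elim: n => [|n IH] //=; apply: measurable_funM.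
  exact: (measurableT_comp IH measurable_fst).
exact: (measurableT_comp mw measurable_snd).
Qed.

Variable rho : R.
Hypothesis rhoE : (\int[gmu G]_x (w x)%:E = rho%:E)%E.

(** By Tonelli's theorem the mean weight is multiplicative; [tensor_powerS G n] has [n.+1]
    factors. *)
Let integral_pw n : (\int[gmu (tensor_powerS G n)]_x (power_weight x)%:E = (rho ^+ n.+1)%:E)%E.
Proof.
elim: n => [|n IH]; first by rewrite expr1.
rewrite [LHS](fubini_tonelli1
  (fun z : tensor_powerS G n * G => (power_weight z.1 * w z.2)%:E)) /fubini_F /=; last 2 first.
- by apply/measurable_EFinP; exact: (@mpw n.+1).
- by move=> z; rewrite lee_fin mulr_ge0// ltW.
under eq_integral => x _.
  under eq_integral => y _ do rewrite EFinM.
  rewrite ge0_integralZl//; last 3 first.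
  + exact/measurable_EFinP.
  + by move=> y _; rewrite lee_fin ltW.
  + by rewrite lee_fin ltW.
  over.
rewrite ge0_integralZr//; last 3 first.
- exact/measurable_EFinP.
- by move=> y _; rewrite lee_fin ltW.
- by apply: integral_ge0 => y _; rewrite lee_fin ltW.
by rewrite IH rhoE -EFinM [in RHS]exprSr.
Qed.

(** Markov's inequality at level 1 bounds the set of weight at least 1; its complement is
    independent, as two weights below 1 have product below 1. *)
Lemma power_weight_alphabar n :
  ((1 - rho ^+ n.+1)%:E <= alphabar (tensor_powerS G n))%E.
Proof.
pose J := [set x : tensor_powerS G n | 1 <= power_weight x].
have mJ : measurable J.
  rewrite -[X in measurable X]setTI.
  have := @mpw n measurableT _ (measurable_itv `[1, +oo[).
  by congr measurable; congr (_ `&` _); apply/seteqP; split=> x /=; rewrite in_itv /= andbT.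
have muJ : (gmu _ J <= (rho ^+ n.+1)%:E)%E.
  rewrite -integral_pw -[leLHS]mul1e -integral_cst//.
  apply: (@le_trans _ _ (\int[gmu (tensor_powerS G n)]_(x in J) (power_weight x)%:E)%E).
    apply: ge0_le_integral => //.
    by apply/measurable_EFinP; exact: measurable_funTS.
  apply: ge0_subset_integral => //; first exact/measurable_EFinP.
  by move=> x _; rewrite lee_fin ltW.
apply: (@le_trans _ _ (gmu _ (~` J))).
  by rewrite probability_setC// EFinB leeB.
apply: alphabar_ge; first exact: measurableC.
move=> x y /negP; rewrite -ltNge => x1 /negP; rewrite -ltNge => y1 /pw_adj.
by rewrite leNgt mulr_ilt1// ltW.
Qed.

End power_weight.

Lemma expanding_powers G I : (forall A : set G, measurable A) ->
    independent I -> (gmu G (neighborhood I) < gmu G I)%E ->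
  (alphabar (tensor_powerS G n) @[n --> \oo] --> (1%E : \bar R)).
Proof.
move=> mG iI; set N := neighborhood I.
pose p := fine (gmu G I); pose q := fine (gmu G N).
have muI : gmu G I = p%:E by rewrite fineK// fin_num_measure.
have muN : gmu G N = q%:E by rewrite fineK// fin_num_measure.
rewrite muI muN lte_fin => qp.
have q0 : 0 <= q by rewrite fine_ge0.
have p0 : 0 < p by exact: le_lt_trans qp.
have IN : I `&` N = set0.
  by apply/seteqP; split=> // x [Ix [y Iy yx]]; exact: (iI _ _ Iy Ix yx).
(* The midpoint of [q / p] and 1: both [a < 1] and [q / a < p] are needed for [rho < 1]. *)
pose a := (1 + q / p) / 2.
have qp1 : q / p < 1 by rewrite ltr_pdivrMr// mul1r.
have qp0 : 0 <= q / p by rewrite divr_ge0// ltW.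
have a0 : 0 < a by rewrite /a; lra.
have a1 : a < 1 by rewrite /a; lra.
have aV1 : 1 < a^-1 by rewrite invf_gt1.
pose w x := if x \in I then a else if x \in N then a^-1 else 1.
have w_gt0 x : 0 < w x by rewrite /w; do 2 case: ifP => // _; rewrite invr_gt0.
(* Only vertices of [I] weigh less than 1, and their neighbours lie in [N], where the weight [a^-1]
   compensates exactly. *)
have w_adj x y : adj G x y -> 1 <= w x * w y.
  have w_ge1 z : z \notin I -> 1 <= w z.
    by rewrite /w => /negbTE ->; case: ifP => // _; exact: ltW.
  have key z z' : adj G z z' -> z \in I -> 1 <= w z * w z'.
    move=> zz' zI; have z'N : z' \in N by apply/mem_set; exists z => //; exact/set_mem.
    rewrite /w zI z'N ifF ?mulfV ?gt_eqF//; apply/negP => /set_mem Iz'.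
    exact: (iI _ _ (set_mem zI) Iz' zz').
  move=> xy; have [xI|xI] := boolP (x \in I); first exact: key.
  have [yI|yI] := boolP (y \in I); first by rewrite mulrC; apply: key => //; exact: adj_sym.
  by rewrite mulr_ege1// w_ge1.
have mw : measurable_fun setT w by move=> _ B _; exact: mG.
pose rho := p * a + q / a + (1 - p - q).
have rhoE : (\int[gmu G]_x (w x)%:E)%E = rho%:E.
  have mfw (A : set G) : measurable_fun A (fun x => (w x)%:E).
    by apply/measurable_EFinP; exact: measurable_funTS.
  have wge0 x : (0 <= (w x)%:E)%E by rewrite lee_fin ltW.
  have intc A c : (forall x, A x -> w x = c) -> (\int[gmu G]_(x in A) (w x)%:E = c%:E * gmu G A)%E.
    move=> wc; rewrite -integral_cst//; apply: eq_integral => x /set_mem Ax.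
    by rewrite wc.
  have NCE : ~` I = N `|` ~` (I `|` N).
    apply/seteqP; split=> x /=; first by move=> Ix; case: (pselect (N x)); [left|right; case].
    move=> [Nx|+ Ix]; last by apply; left.
    by move=> Ix; have : set0 x by rewrite -IN.
  rewrite -(setUv I) ge0_integral_setU//; last by apply/disj_setPS; rewrite setICr.
  rewrite NCE ge0_integral_setU//; last first.
    by apply/disj_setPS => x [Nx]; apply; right.
  rewrite (intc I a) ?(intc N a^-1) ?(intc _ 1).
  - have muIN : gmu G (I `|` N) = (p + q)%:E.
      by rewrite measureU// EFinD -muI -muN.
    rewrite probability_setC// muIN muI muN mul1e -EFinB -!EFinM -!EFinD; congr EFin.
    by rewrite /rho; ring.
  - by move=> x IN'; rewrite /w !ifF//; apply/negP => /set_mem ?; apply: IN'; [right|left].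
  - move=> x Nx; rewrite /w (mem_set Nx) ifF//; apply/negP => /set_mem Ix.
    by have : set0 x by rewrite -IN.
  - by move=> x Ix; rewrite /w mem_set.
(* This rests on the factorisation [1 - rho = (1 - a) * (p - q / a)]. *)
have rho1 : rho < 1.
  have : q / a < p by rewrite ltr_pdivrMr// /a mulrC; have := divfK (lt0r_neq0 p0) q; nra.
  rewrite -subr_gt0 => /(mulr_gt0 (_ : 0 < 1 - a)); rewrite subr_gt0 => /(_ a1).
  have : q / a * a = q by rewrite divfK// gt_eqF.
  by rewrite /rho; nra.
have rho0 : 0 <= rho.
  by rewrite -lee_fin -rhoE; apply: integral_ge0 => x _; rewrite lee_fin ltW.
apply: (@squeeze_cvge _ _ _ _ (fun n => (1 - rho ^+ n.+1)%:E) _ (cst 1%E)).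
- apply: nearW => n; rewrite alphabar_le1 andbT.
  exact: (power_weight_alphabar w_gt0 w_adj mw rhoE).
- apply/cvg_EFin; first exact: nearW.
  rewrite -[X in _ --> X]subr0; apply: cvgB; first exact: cvg_cst.
  have /cvg_expr : `|rho| < 1 by rewrite ger0_norm.
  by rewrite -cvg_shiftS.
- exact: cvg_cst.
Qed.

End expanding.

(** * The antipodal circle and descriptors of a finite graph *)

Section descriptors.
Context {R : realType}.
Local Notation RR := (measurableTypeR R).
Implicit Types G H : mgraph R.

Definition antipodal (x y : R) :=
  [/\ 0 <= x < 1, 0 <= y < 1 & x - y = 2^-1 \/ y - x = 2^-1].

Lemma antipodal_sym x y : antipodal x y -> antipodal y x.
Proof. by move=> [x01 y01 [xy|xy]]; split=> //; [right|left]. Qed.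

Lemma antipodal_irr x : ~ antipodal x x.
Proof. by move=> [_ _ []]; lra. Qed.

Lemma antipodal_rotation s x y : antipodal x y -> antipodal (rotation s x) (rotation s y).
Proof.
move=> [x01 y01 xy]; split; [exact: rotation_itv..|].
rewrite /rotation x01 y01 !andbT; case: ifP => // s01.
by case: xy => xy; case: ifP => ?; case: ifP => ?; lra.
Qed.

Definition antipodal_circle : mgraph R :=
  circle_graph antipodal_sym antipodal_irr.

Lemma coupled_antipodal_circle : coupled antipodal_circle.
Proof.
(* [coupled] asks for an edge at every outcome, so the null set outside [0, 1) is sent to 0. The
   random edge joins a uniform point to its image under a half-turn. *)
pose clamp (x : R) := if 0 <= x < 1 then x else 0.
have clamp01 x : 0 <= clamp x < 1 by rewrite /clamp; case: ifP => // _; lra.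
have mclamp : measurable_fun [set: RR] (clamp : RR -> RR).
  apply: measurable_fun_ifT => //; exact: measurable_circle.
have clampE (A : set RR) : circle_mu (clamp @^-1` A) = circle_mu A.
  rewrite /circle_mu /mrestr; congr (lebesgue_measure _).
  by apply/seteqP; split=> x /=; rewrite in_itv /= /clamp => -[+ x01]; rewrite x01.
have mrot := @measurable_rotation R 2^-1.
exists _, RR, (@circle_mu R), clamp, (rotation 2^-1 \o clamp); split.
- move=> x /=; have c01 := clamp01 x; split; [exact: c01|exact: rotation_itv|].
  rewrite /rotation c01 andbT ifT; last lra.
  by case: ifP => ?; lra.
- exact: mclamp.
- exact: (measurableT_comp mrot mclamp).
- by move=> A _; exact: clampE.
- by move=> A mA; rewrite comp_preimage; apply: etrans (clampE _) _; exact: circle_mu_rotation.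
Qed.

Lemma circle_mp_hom e (es : forall x y, e x y -> e y x) (ei : forall x, ~ e x x) G
    (h : R -> G) :
    (forall x y, e x y -> adj G (h x) (h y)) ->
    (forall A : set G, measurable (h @^-1` A : set RR)) ->
    (forall A : set G, measurable A -> circle_mu (h @^-1` A) = gmu G A) ->
  maps_to (circle_graph es ei) G.
Proof.
by move=> hh mh hE; exists h; split=> //; split=> // _ A _; rewrite setTI; exact: mh.
Qed.

Section finite.
Variable G : mgraph R.
Hypothesis finG : finite_graph G.

Let X := fset_set [set: G].

Let mG (A : set G) : measurable A. Proof. exact: finG.2. Qed.

Let inX x : x \in X. Proof. by rewrite in_fset_set ?inE//; exact: finG.1. Qed.

Let gmu_fin (A : set G) : gmu G A \is a fin_num.
Proof. by rewrite fin_num_measure. Qed.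

Lemma gmu_sum (A : set G) :
  gmu G A = (\sum_(x <- X | x \in A) fine (gmu G [set x]))%:E.
Proof.
have finA : finite_set A by exact: sub_finite_set finG.1.
rewrite [in LHS](_ : A = \bigcup_(x in A) [set x]); last by rewrite bigcup_imset1 image_id.
rewrite measure_fin_bigcup//; last by move=> i j _ _ [x [-> ->]].
rewrite fsbig_mkcond fsbig_finite; last exact: finG.1.
rewrite (eq_bigr (fun x => if x \in A then gmu G [set x] else 0%E))//.
rewrite -big_mkcond -sumEFin /=; apply: eq_bigr => x _.
by rewrite fineK.
Qed.

(** An edgeless circle suffices. With no descriptor at all the infimum in [upper_ratio] would be
    infinite. *)
Lemma finite_descriptor : exists H, descriptor G H.
Proof.
have [g [_ mg gE]] := step_function point X 0 (fun t : G => fine_ge0 (measure_ge0 (gmu G) [set t])).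
pose e (x y : R) := False.
have es x y : e x y -> e y x by [].
have ei x : ~ e x x by [].
exists (circle_graph es ei); split; first exact: circle_vertex_transitive.
apply: (@circle_mp_hom _ _ _ _ g) => //.
move=> A _; rewrite [RHS]gmu_sum -gE setIC /circle_mu /mrestr.
suff -> : \sum_(t <- X) fine (gmu G [set t]) = 1 by rewrite add0r.
apply/EFin_inj; rewrite -(probability_setT (gmu G)) gmu_sum.
by congr EFin; apply: eq_bigl => x; rewrite mem_set.
Qed.

(** The weights [w] are the law of a random ordered edge. A point of the first half-circle selects
    an edge and goes to its first end, while the opposite point goes to the second end. *)
Lemma antipodal_circle_maps_to (w : X -> X -> R) :
  (forall u v, 0 <= w u v) -> (forall u v, w u v != 0 -> adj G (val u) (val v)) ->
  (forall u v, w u v = w v u) ->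
  (forall u, \sum_v w u v = fine (gmu G [set val u])) ->
  maps_to antipodal_circle G.
Proof.
move=> w0 w_adj w_sym w_sum.
(* Pairs of weight 0 are discarded so that every value of the step function, its default included,
   is an edge. *)
pose s := [seq p <- index_enum (X * X)%type | w p.1 p.2 != 0].
(* Halved because the intervals have to fill [0, 1/2) only. *)
pose w2 (p : X * X) := w p.1 p.2 / 2.
have w20 p : 0 <= w2 p by rewrite divr_ge0.
have sumA1 (A : set G) : (\sum_(p <- s | val p.1 \in A) w2 p)%:E = ((2^-1)%:E * gmu G A)%E.
  rewrite gmu_sum -EFinM; congr EFin.
  rewrite big_filter_cond big_seq_fsetE /= mulr_sumr.
  transitivity (\sum_(p | val p.1 \in A) w2 p).
    rewrite [RHS](bigID (fun p => w p.1 p.2 != 0)) /= [X in _ = _ + X]big1 ?addr0.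
      by apply: eq_bigl => p; rewrite andbC.
    by move=> p /andP[_ /negPn/eqP]; rewrite /w2 => ->; rewrite mul0r.
  transitivity (\sum_(u | val u \in A) \sum_v w2 (u, v)).
    by rewrite pair_big /=; apply: eq_big => [p|[u v]//]; rewrite andbT.
  by apply: eq_bigr => u _; rewrite -w_sum /w2 /= -mulr_suml mulrC.
have sumA2 (A : set G) : (\sum_(p <- s | val p.2 \in A) w2 p)%:E = ((2^-1)%:E * gmu G A)%E.
  rewrite -sumA1; congr EFin; rewrite !big_filter_cond.
  rewrite (reindex_inj (h := fun p : X * X => (p.2, p.1))) /=; last first.
    by move=> [a b] [c d] [-> ->].
  apply: eq_big => [p|p _]; first by rewrite w_sym.
  by rewrite /w2 /= w_sym.
have sum1 : \sum_(p <- s) w2 p = 2^-1.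
  apply/EFin_inj; rewrite -[RHS]mule1 -(probability_setT (gmu G)) -sumA1.
  by congr EFin; apply: eq_bigl => p; rewrite mem_set.
have [p0 p0s] : exists p0, p0 \in s.
  case: s sum1 {sumA1 sumA2} => [|p0 s' _]; last by exists p0; rewrite mem_head.
  by rewrite big_nil; lra.
have [g [gs mg gE]] := step_function p0 s 0 w20.
have g_adj x : adj G (val (g x).1) (val (g x).2).
  apply: w_adj; have : g x \in s.
    by have := gs x; rewrite inE => /orP[/eqP ->|].
  by rewrite mem_filter => /andP[].
pose h x := if x < 2^-1 then val (g x).1 else val (g (x - 2^-1)).2.
pose A1 (A : set G) := [set p : X * X | A (val p.1)].
pose A2 (A : set G) := [set p : X * X | A (val p.2)].
have mA2 (A : set G) : measurable ((fun x : RR => x + - 2^-1) @^-1` (g @^-1` A2 A) : set RR).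
  by rewrite -[X in measurable X]setTI; exact: measurable_shift.
apply: (@circle_mp_hom _ _ _ _ h).
- have h_adj x y : 0 <= y -> x < 1 -> x - y = 2^-1 -> adj G (h x) (h y).
    move=> y0 x1 xy; rewrite /h ifF; last lra.
    rewrite ifT; last lra.
    have -> : x - 2^-1 = y by lra.
    exact: adj_sym.
  move=> x y [/andP[x0 x1] /andP[y0 y1] [xy|xy]]; first exact: h_adj.
  by apply: adj_sym; exact: h_adj.
- move=> A.
  have -> : h @^-1` A = (`]-oo, 2^-1[ `&` g @^-1` A1 A) `|`
     (`[2^-1, +oo[ `&` (fun x => x - 2^-1) @^-1` (g @^-1` A2 A)).
    apply/seteqP; split=> x /=; rewrite !in_itv /= andbT /h.
      by case: ltP => hx Ax; [left|right].
    by move=> [] [hx Ax]; [rewrite hx|rewrite ltNge hx].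
  apply: measurableU; first by apply: measurableI.
  by apply: measurableI => //; exact: mA2.
- move=> A _; rewrite /circle_mu /mrestr.
  (* Each half-circle contributes half of [gmu G A], the second one after translation back to [0,
     1/2). *)
  have -> : h @^-1` A `&` `[0, 1[ = (`[0, 2^-1[ `&` g @^-1` A1 A) `|`
     (fun x => x - 2^-1) @^-1` (`[0, 2^-1[ `&` (g @^-1` A2 A)).
    apply/seteqP; split=> x /=; rewrite !in_itv /= /h.
      by case: ltP => hx [Ax x01]; [left|right]; split=> //; lra.
    move=> [] [hx Ax]; first by rewrite ifT; [split=> //; lra|lra].
    by rewrite ifF; [split=> //; lra|lra].
  rewrite measureU; last 3 first.
  + by apply: measurableI; [exact: measurable_itv|exact: mg].
  + rewrite preimage_setI; apply: measurableI; last exact: mA2.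
    by rewrite -[X in measurable X]setTI; exact: measurable_shift.
  + by apply/seteqP; split=> x //=; rewrite !in_itv /=; lra.
  have E1 := gE (A1 A); have E2 := gE (A2 A).
  rewrite !add0r sum1 in E1 E2.
  have -> : gmu G A = ((2^-1)%:E * gmu G A + (2^-1)%:E * gmu G A)%E.
    by rewrite -(fineK (gmu_fin A)) -!EFinM -EFinD; congr EFin; lra.
  congr (_ + _)%E.
    by rewrite -sumA1; exact: E1.
  rewrite -sumA2; apply: (etrans (lebesgue_measure_shift _ _)).
    by apply: measurableI; [exact: measurable_itv|exact: mg].
  exact: E2.
Qed.

(** This dichotomy serves both converse implications: a coupled descriptor keeps [upper_ratio G] and
    all powers of [G] at ratio at most one half. *)
Lemma expanding_or_coupled :
  (exists2 I : set G, independent I & (gmu G (neighborhood I) < gmu G I)%E) \/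
  (exists2 H, descriptor G H & coupled H).
Proof.
have e_sym : symmetric (fun u v : X => `[< adj G (val u) (val v) >]).
  by move=> u v; apply/asboolP/asboolP => /adj_sym.
have e_irr : irreflexive (fun u v : X => `[< adj G (val u) (val v) >]).
  by move=> u; apply/asboolP => /adj_irr.
have [|[w [w0 we ws wm]]|[I iI ltI]] :=
  @fractional_matching R X _ (fun u => fine (gmu G [set val u])) e_sym e_irr.
- by move=> u; rewrite fine_ge0.
- right; exists antipodal_circle; last exact: coupled_antipodal_circle.
  split; first by apply: circle_vertex_transitive; exact: antipodal_rotation.
  by apply: (antipodal_circle_maps_to w0) => // u v /we /asboolP.
left; pose J := [set x | exists2 u, u \in I & val u = x].
have JE u : (val u \in J) = (u \in I).
  apply/idP/idP => [/set_mem[v vI /val_inj <-]//|uI].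
  by apply/mem_set; exists u.
exists J.
  move=> _ _ [u uI <-] [v vI <-] uv; have /negP := iI _ _ uI vI; apply.
  exact/asboolP.
rewrite !gmu_sum lte_fin !big_seq_fsetE /=.
under [ltRHS]eq_bigl => u do rewrite JE.
rewrite (eq_bigl _ _ (_ : _ =1 fun v => [exists u in I, `[< adj G (val u) (val v) >]]))//.
move=> v; apply/idP/existsP => [/set_mem[_ [u uI <-] uv]|[u /andP[uI /asboolP uv]]].
  by exists u; rewrite uI; exact/asboolP.
by apply/mem_set; exists (val u) => //; exists u.
Qed.

End finite.
End descriptors.

(** * Equivalence of the three conditions *)

Local Open Scope ereal_scope.

Theorem theorem1 (R : realType) (G : mgraph R) (finG : finite_graph G) :
  ((alphabar (tensor_powerS G n) @[n --> \oo] --> (1 : \bar R))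
     <-> upper_ratio G = 1) /\
  (upper_ratio G = 1
     <-> exists2 I : set G, independent I & gmu G (neighborhood I) < gmu G I).
Proof.
have half_lt1 : (2^-1)%:E < 1 :> \bar R by rewrite lte_fin; lra.
have iii_i : (exists2 I : set G, independent I & gmu G (neighborhood I) < gmu G I) ->
    alphabar (tensor_powerS G n) @[n --> \oo] --> (1 : \bar R).
  by move=> [I iI ltI]; exact: expanding_powers finG.2 iI ltI.
have iii_ii : (exists2 I : set G, independent I & gmu G (neighborhood I) < gmu G I) ->
    upper_ratio G = 1.
  move=> [I iI ltI]; rewrite /upper_ratio.
  (* Every descriptor has ratio 1, and at least one descriptor exists. *)
  rewrite (_ : [set a | _] = [set 1]) ?ereal_inf1//.
  apply/seteqP; split=> [_ [H dH <-]|_ ->].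
    exact: vertex_transitive_alphabar1 finG.2 dH iI ltI.
  have [H dH] := finite_descriptor finG; exists H => //.
  exact: vertex_transitive_alphabar1 finG.2 dH iI ltI.
have ii_iii : upper_ratio G = 1 ->
    exists2 I : set G, independent I & gmu G (neighborhood I) < gmu G I.
  move=> u1; have [//|[H dH /coupled_alphabar cH]] := expanding_or_coupled finG.
  have := le_lt_trans cH half_lt1; rewrite ltNge -u1 => /negP[].
  by apply: ereal_inf_lbound; exists H.
have i_iii : alphabar (tensor_powerS G n) @[n --> \oo] --> (1 : \bar R) ->
    exists2 I : set G, independent I & gmu G (neighborhood I) < gmu G I.
  move=> lim1; have [//|[H [_ HG] cH]] := expanding_or_coupled finG.
  (* The random edge is carried from the descriptor to [G], and from there to all its powers. *)
  have cG := coupled_maps_to HG cH.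
  have : limn (fun n => alphabar (tensor_powerS G n)) <= (2^-1)%:E.
    apply: lime_le; first by apply/cvg_ex; exists 1.
    by apply: nearW => n; apply: coupled_alphabar; exact: coupled_tensor_powerS.
  by rewrite (cvg_lim _ lim1)// leNgt half_lt1.
by split; split; [move/i_iii/iii_ii|move/ii_iii/iii_i|move/ii_iii|move/iii_ii].
Qed.
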